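(* ($n\times n$ Meixner type polynomials.) In the setting of the context, the matrices $L(j)$ and $(e_0,\Phi_j)=L(j)\operatorname{diag}(w_{nj}^{1/2},\dots,w_{nj+n-1}^{1/2})$ are invertible for all $j\ge0$. Put $\theta_j=(e_0,\Phi_j)\alpha_j^*(e_0,\Phi_j)^{-1}$. Then there is a family of matrix valued polynomials $\Pi_k(x)=\sum_{i=0}^kM_{k,i}x^i$, $k\geq 0$ ($M_{k,i}\in M_n(\mathbb C)$, $M_{k,k}$ invertible, $x\in M_n(\mathbb C)$), such that for all integers $j,k,\ell\ge0$: (i) (recurrence) $\Pi_k(\theta_j)\theta_j=A_{k+1}^*\Pi_{k+1}(\theta_j)+B_k\Pi_k(\theta_j)+A_k\Pi_{k-1}(\theta_j)$, with $\Pi_{-1}(\theta_j)=0$, $\Pi_0(\theta_j)=I_n$; (ii) (orthogonality) $\sum_{j=0}^\infty\Pi_k(\theta_j)W(j)\Pi_\ell(\theta_j)^*=\delta_{k,\ell}I_n$, where $W(j)=L(j)D(j)L(j)^*$ and $D(j)=\operatorname{diag}(w_{nj},\dots,w_{nj+n-1})$; (iii) (difference equation) with $\Lambda_k=\operatorname{diag}(\lambda_{nk}^n,\dots,\lambda_{nk+n-1}^n)$, $$\Lambda_k\Pi_k(\theta_j)=\Pi_k(\theta_{j+1})(e_0,\Phi_{j+1})A_{j+1}(e_0,\Phi_j)+\Pi_k(\theta_j)(e_0,\Phi_j)B_j(e_0,\Phi_j)+\Pi_k(\theta_{j-1})(e_0,\Phi_{j-1})A_j^*(e_0,\Phi_j),$$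 where the last term is omitted for $j=0$.
   Context: $A^*$ is the conjugate transpose. Let $n\ge1$, $\beta>0$, and $a\in\mathbb R$ with $a\neq0$. Let $V$ be the discrete series representation of $\mathfrak{su}(1,1)$ described on the orthonormal basis $|k\rangle$, $k=0,1,2,\dots$, by $$H|k\rangle=\lambda_k|k\rangle,\ \lambda_k=\tfrac\beta2+k;\quad L^+|k\rangle=\rho_k^+|k+1\rangle,\ \rho_k^+=\sqrt{(k+1)(\beta+k)};\quad L^-|k\rangle=\rho_k^-|k-1\rangle,\ \rho_k^-=\sqrt{k(\beta+k-1)},$$ and let $P=-\frac12\sinh(a)(L^++L^-)+\cosh(a)H$. It is taken as known that $P$ has eigenbasis $|\phi_j\rangle$, $P|\phi_j\rangle=\mu_j|\phi_j\rangle$, $\mu_j=\frac\beta2+j$, $j=0,1,\dots$, on which $$H|\phi_j\rangle=-\tfrac12\sinh(a)\rho_j^+|\phi_{j+1}\rangle+\cosh(a)\lambda_j|\phi_j\rangle-\tfrac12\sinh(a)\rho_j^-|\phi_{j-1}\rangle,$$ and that the transition coefficients are $\langle k|\phi_j\rangle=M_k(j;\beta,c)h_k^{-1/2}w_j^{1/2}$, where $c=\left(\frac{\cosh a-1}{\sinh a}\right)^2$ and $$M_k(x;\beta,c)={}_2F_1\!\left(-x,-k;\beta;1-\tfrac1c\right)=\sum_{i=0}^k\frac{(-x)_i(-k)_i}{(\beta)_i\,i!}\left(1-\tfrac1c\right)^i,\quad w_j=\frac{(\beta)_j}{j!}c^j,\quad h_k=\frac{k!}{(\beta)_k(1-c)^\beta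 c^k}$$ (Meixner polynomials, their weight and squared norms; $(x)_i$ is the Pochhammer symbol). $V^n$ is the left $M_n(\mathbb C)$-module with action $A(v_1,\dots,v_n)=(\sum_ka_{1k}v_k,\dots,\sum_ka_{nk}v_k)$ and matrix valued inner product $(v,w)=(\langle v_i,w_j\rangle)_{i,j}$; operators on $V$ act on $V^n$ componentwise. For $k,j\ge0$ put $e_k=(|nk\rangle,\dots,|nk+n-1\rangle)$, $\Phi_j=(|\phi_{nj}\rangle,\dots,|\phi_{nj+n-1}\rangle)$ and $\alpha_j=\operatorname{diag}(\mu_{nj}^n,\dots,\mu_{nj+n-1}^n)$; thus $(e_0,\Phi_j)$ has $(i,\ell)$ entry $\langle i-1|\phi_{nj+\ell-1}\rangle$. The matrices $A_k$ ($k\ge1$) and $B_k=B_k^*$ ($k\ge0$) in $M_n(\mathbb C)$ are defined by $$P^n\cdot e_k=A_{k+1}^*e_{k+1}+B_ke_k+A_ke_{k-1},\qquad e_{-1}=0.$$ The matrix $L(j)\in M_n(\mathbb C)$ is $L(j)_{i,\ell}=h_{i-1}^{-1/2}M_{i-1}(nj+\ell-1;\beta,c)$, $i,\ell=1,\dots,n$.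
   Formalization: In (iii) the last factor of each right-hand term is the inverse of (e_0,Φ_j), since the printed formula fails for n=1, j=k=0; for a<0 the roots w_j^{1/2} and h_k^{-1/2} carry the signs sgn(a)^j and sgn(a)^k, as P φ_j = μ_j φ_j requires. *)

(* Defs.v *)
From HB Require Import structures.
From mathcomp Require Import all_boot all_order all_algebra.
From mathcomp Require Import complex.
From mathcomp Require Import all_classical all_reals all_analysis.

Set Implicit Arguments.
Unset Strict Implicit.
Unset Printing Implicit Defensive.

Import Order.TTheory GRing.Theory Num.Theory.
Import numFieldNormedType.Exports.

Local Open Scope classical_set_scope.
Local Open Scope ring_scope.
Local Open Scope sesquilinear_scope.

(* R[i] packed as a numClosedFieldType, so that it and the matrices over it
   carry the topology of the modulus. *)
Definition Cplx (R : realType) : numClosedFieldType := R[i].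

Definition toC (R : realType) (x : R) : Cplx R := real_complex R x.

Section Scalars.
Variables (R : realType) (beta a : R).

Definition sinh (x : R) : R := (expR x - expR (- x)) / 2.
Definition cosh (x : R) : R := (expR x + expR (- x)) / 2.

Definition poch (x : R) (i : nat) : R := \prod_(m < i) (x + m%:R).

Definition lambda (k : nat) : R := beta / 2 + k%:R.
Definition mu (j : nat) : R := beta / 2 + j%:R.
Definition rho_plus (k : nat) : R := Num.sqrt ((k%:R + 1) * (beta + k%:R)).
Definition rho_minus (k : nat) : R := Num.sqrt (k%:R * (beta + k%:R - 1)).

Definition meixner_c : R := ((cosh a - 1) / sinh a) ^+ 2.

Definition meixner (k : nat) (x : R) : R :=
  \sum_(i < k.+1)
    poch (- x) i * poch (- k%:R) i / (poch beta i * (i`!)%:R)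
      * (1 - meixner_c^-1) ^+ i.

Definition meixner_weight (j : nat) : R := poch beta j / (j`!)%:R * meixner_c ^+ j.

Definition meixner_sqnorm (k : nat) : R :=
  (k`!)%:R / (poch beta k * (1 - meixner_c) `^ beta * meixner_c ^+ k).

(* w_j^(1/2) and h_k^(-1/2) contain c^(j/2) and c^(k/2). Here c^(1/2) stands
   for (cosh a - 1) / sinh a = tanh (a / 2), which has the sign of a. For
   0 < a these are the nonnegative square roots. For a < 0 the nonnegative
   square roots would give eigenvectors of the operator with parameter - a
   instead of eigenvectors of P. *)
Definition sqrt_weight (j : nat) : R :=
  Num.sg a ^+ j * Num.sqrt (meixner_weight j).
Definition invsqrt_sqnorm (k : nat) : R :=
  Num.sg a ^+ k * Num.sqrt (meixner_sqnorm k)^-1.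

End Scalars.

Section Representation.
Variable R : realType.
Local Notation C := (Cplx R).

(* A vector of V is given by its coefficients v k = <k|v> in the orthonormal
   basis. The operators H, L^+, L^- are unbounded; they are banded, so their
   formulas on the basis make sense on every sequence of coefficients, and the
   square-summable sequences are not singled out as a type. *)
Definition V : Type := nat -> C^o.
HB.instance Definition _ := GRing.Lmodule.on V.

Definition ket (k : nat) : V := fun m => (m == k)%:R.

(* Linear in the first argument, so that (A v, w) = A (v, w) and
   (v, A w) = (v, w) A^* for the matrix valued inner product below. *)
Definition ip (v w : V) : C :=
  limn (series (fun k => (v k : C) * Num.conj (w k : C))).

Lemma ip_ket k (v : V) : ip (ket k) v = Num.conj (v k : C).
Proof.
rewrite /ip; apply: lim_near_cst => //.
near=> N.
have kN : (k < N)%N by near: N; exists k.+1.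
rewrite /series /= (bigD1_seq k) ?mem_index_iota ?iota_uniq //=.
rewrite /ket eqxx mul1r big1 ?addr0 // => i /negPf ->.
by rewrite mul0r.
Unshelve. all: by end_near. Qed.

Variables beta a : R.

Definition Hop (v : V) : V := fun m => toC (lambda beta m) * v m.
Definition Lplus (v : V) : V :=
  fun m => if m is m'.+1 then toC (rho_plus beta m') * v m' else 0.
Definition Lminus (v : V) : V :=
  fun m => toC (rho_minus beta m.+1) * v m.+1.
Definition Pop (v : V) : V :=
  - toC (sinh a / 2) *: (Lplus v + Lminus v) + toC (cosh a) *: Hop v.

Lemma Hop_ket k : Hop (ket k) = toC (lambda beta k) *: ket k.
Proof.
apply/funext => m.
change (toC (lambda beta m) * ket k m = toC (lambda beta k) * ket k m).
by rewrite /ket; case: eqP => [->|_] //; rewrite !mulr0.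
Qed.

Lemma Lplus_ket k : Lplus (ket k) = toC (rho_plus beta k) *: ket k.+1.
Proof.
apply/funext => m.
change (Lplus (ket k) m = toC (rho_plus beta k) * ket k.+1 m).
case: m => [|m]; rewrite /Lplus /ket ?eqSS; first by rewrite mulr0.
by case: eqP => [->|_] //; rewrite !mulr0.
Qed.

Lemma Lminus_ket k :
  Lminus (ket k) = toC (rho_minus beta k) *: (if k is k'.+1 then ket k' else 0).
Proof.
apply/funext => m; case: k => [|k].
  by rewrite scaler0 /Lminus /ket mulr0.
change (Lminus (ket k.+1) m = toC (rho_minus beta k.+1) * ket k m).
rewrite /Lminus /ket eqSS.
by case: eqP => [->|_] //; rewrite !mulr0.
Qed.

Definition phi (j : nat) : V :=
  fun k => toC (meixner beta a k j%:R * invsqrt_sqnorm beta a k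
                * sqrt_weight beta a j).

Variable n : nat.

Definition Vn : Type := 'I_n -> V.
HB.instance Definition _ := GRing.Zmodule.on Vn.

Definition mxact (A : 'M[C]_n) (v : Vn) : Vn := fun i => \sum_k A i k *: v k.
Definition opact (T : V -> V) (v : Vn) : Vn := fun i => T (v i).
Definition mxip (v w : Vn) : 'M[C]_n := \matrix_(i, j) ip (v i) (w j).

Definition evec (k : nat) : Vn := fun i => ket (n * k + i)%N.
Definition Phi (j : nat) : Vn := fun i => phi (n * j + i)%N.

Definition alpha (j : nat) : 'M[C]_n :=
  diag_mx (\row_i toC (mu beta (n * j + i)%N ^+ n)).
Definition Lambda (k : nat) : 'M[C]_n :=
  diag_mx (\row_i toC (lambda beta (n * k + i)%N ^+ n)).

Definition Lmx (j : nat) : 'M[C]_n :=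
  \matrix_(i, l) toC (invsqrt_sqnorm beta a i
                      * meixner beta a i (n * j + l)%:R).
Definition Dsqrt (j : nat) : 'M[C]_n :=
  diag_mx (\row_i toC (sqrt_weight beta a (n * j + i)%N)).
Definition D (j : nat) : 'M[C]_n :=
  diag_mx (\row_i toC (meixner_weight beta a (n * j + i)%N)).
Definition W (j : nat) : 'M[C]_n := Lmx j *m D j *m (Lmx j)^t*.

Definition theta (j : nat) : 'M[C]_n :=
  mxip (evec 0) (Phi j) *m (alpha j)^t* *m invmx (mxip (evec 0) (Phi j)).

(* The relation P^n e_k = A_{k+1}^* e_{k+1} + B_k e_k + A_k e_{k-1}, with
   e_{-1} = 0; it determines A k for 0 < k and B k, and leaves A 0 free. *)
Definition block_tridiagonal (A B : nat -> 'M[C]_n) : Prop :=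
  forall k : nat,
    opact (iter n Pop) (evec k)
    = mxact ((A k.+1)^t*) (evec k.+1) + mxact (B k) (evec k)
      + (if k is k'.+1 then mxact (A k) (evec k') else 0).

Definition matpoly (M : nat -> nat -> 'M[C]_n) (k : nat) (x : 'M[C]_n)
  : 'M[C]_n := \sum_(i < k.+1) M k i *m x ^+ i.

End Representation.

Arguments evec R n k : clear implicits.
Arguments Phi [R] beta a n j.
Arguments alpha [R] beta n j.
Arguments Lambda [R] beta n k.
Arguments Lmx [R] beta a n j.
Arguments Dsqrt [R] beta a n j.
Arguments D [R] beta a n j.
Arguments W [R] beta a n j.
Arguments theta [R] beta a n j.

(* Main.v *)
Require Import Defs.
From HB Require Import structures.
From mathcomp Require Import all_boot all_order all_algebra.
From mathcomp Require Import complex.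
From mathcomp Require Import all_classical all_reals all_analysis.
From mathcomp Require Import ring lra zify.

Import Order.TTheory GRing.Theory Num.Theory.
Import numFieldNormedType.Exports.

Local Open Scope classical_set_scope.
Local Open Scope ring_scope.
Local Open Scope sesquilinear_scope.

Set Implicit Arguments.
Unset Strict Implicit.
Unset Printing Implicit Defensive.

(** The coefficients [transition k j = <k|phi_j>] form a real symmetric
    matrix [U]: the Meixner polynomials are self-dual, and
    [h_k^(-1)] is [w_k] up to the factor [(1-c)^beta]. The three-term recurrence
    says [J U = U Lambda], where the Jacobi matrix [J] is that of [P]; transposed,
    it is [U J = Lambda U].

    Orthonormality of the rows of [U] comes from finite truncations. By Green's
    identity for [J], the truncated inner product of two different rows is a
    boundary term, which tends to 0 because the rows decrease rapidly. The
    recurrence then shows that all truncated squared norms have the same limit,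
    and for row 0 this is the binomial series
    [sum_j (beta)_j / j! c^j = (1-c)^(-beta)].

    Cut [U] into [n] x [n] blocks [U_(k,j)]; so [(e_0, Phi_j) = U_(0,j)]. The
    block recurrence [J^n U = U Lambda^n] gives
    [Pi_k(theta_j) U_(0,j) = U_(k,j)], where [Pi_k] is defined by the recurrence
    (i), provided [U_(0,j)] is invertible; it is, because up to diagonal factors
    it evaluates polynomials of degrees [0, ..., n-1] at [n] distinct points.
    Then (ii) is the orthonormality of the rows, and (iii) is the conjugate
    transpose of the block recurrence. *)

(** * The binomial series *)

Lemma summable_of_ratio (R : realType) (u : nat -> R) (r : R) :
  0 < r < 1 -> (\forall n \near \oo, `|u n.+1| <= r * `|u n|) ->
  cvgn (series u).
Proof.
move=> /andP[r0 r1] [N _ uN].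
have rn0 m : 0 < r ^+ m by rewrite exprn_gt0.
(* This constant bounds [|u m| / r ^+ m] for [m <= N], before the ratio hypothesis applies; from [N]
   on the ratio propagates the bound. *)
pose C := \sum_(i < N.+1) `|u i| / r ^+ i.
have C0 : 0 <= C by apply: sumr_ge0 => i _; rewrite divr_ge0// ltW.
have uC m : `|u m| <= C * r ^+ m.
  elim: m => [|m IH].
    rewrite expr0 mulr1 /C big_ord_recl /= expr0 divr1 lerDl.
    by apply: sumr_ge0 => i _; rewrite divr_ge0// ltW.
  have [mN|mN] := ltnP m N.
    rewrite -ler_pdivrMr//.
    have mN' : (m.+1 < N.+1)%N by [].
    rewrite /C (bigD1 (Ordinal mN')) //= lerDl.
    by apply: sumr_ge0 => i _; rewrite divr_ge0// ltW.
  apply: le_trans (uN _ mN) _.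
  by rewrite exprS mulrCA ler_wpM2l// ltW.
apply: normed_cvg.
apply: (@series_le_cvg _ _ (fun m => C * r ^+ m)) => [m|m|m|].
- exact: normr_ge0.
- by rewrite mulr_ge0//; exact: ltW.
- exact: uC.
- by apply: (@is_cvg_geometric_series _ C r); rewrite gtr0_norm.
Qed.

Lemma summable_of_cvg_ratio (R : realType) (u q : nat -> R) (c : R) :
  `|c| < 1 -> (forall n, u n.+1 = q n * u n) -> q @ \oo --> c ->
  cvgn (series u).
Proof.
move=> c1 uq qc; have c0 := normr_ge0 c.
(* The midpoint of [|c|] and 1 leaves room for [q n] to differ from its limit. *)
apply: (@summable_of_ratio _ _ ((`|c| + 1) / 2)); first by apply/andP; split; lra.
have : \forall n \near \oo, `|c - q n| < (1 - `|c|) / 2.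
  by move/cvgrPdist_lt: qc; apply; lra.
apply: filterS => n cq; rewrite uq normrM ler_wpM2r//.
have -> : q n = c - (c - q n) by ring.
rewrite (le_trans (ler_normB _ _))//.
by move/ltW: cq; lra.
Qed.

Lemma poch0 (R : realType) (x : R) : poch x 0 = 1.
Proof. by rewrite /poch big_ord0. Qed.

Lemma pochS (R : realType) (x : R) m : poch x m.+1 = poch x m * (x + m%:R).
Proof. by rewrite /poch big_ord_recr. Qed.

Lemma pochSl (R : realType) (x : R) m : poch x m.+1 = x * poch (x + 1) m.
Proof.
rewrite /poch big_ord_recl addr0; congr (_ * _); apply: eq_bigr => i _.
by rewrite /bump /= -addrA natrD.
Qed.

Lemma poch_gt0 (R : realType) (x : R) m : 0 < x -> 0 < poch x m.
Proof. by move=> x0; apply: prodr_gt0 => i _; rewrite ltr_wpDr. Qed.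

Lemma poch_oppn_eq0 (R : realType) (k m : nat) :
  (k < m)%N -> poch (- k%:R : R) m = 0.
Proof.
by move=> km; rewrite /poch (bigD1 (Ordinal km)) //= addNr mul0r.
Qed.

Section BinomialSeries.
Variable R : realType.
Implicit Types beta x c : R.

Definition binomial_coef beta (j : nat) : R := poch beta j / j`!%:R.

Lemma binomial_coefS beta j :
  binomial_coef beta j.+1 = (beta + j%:R) / j.+1%:R * binomial_coef beta j.
Proof.
rewrite /binomial_coef pochS factS natrM invfM.
by rewrite mulrA -[RHS]mulrA mulrACA [RHS]mulrCA mulrA; ring.
Qed.

(** Termwise differentiation shifts the parameter, because [(beta)_(j+1) = beta * (beta+1)_j]. *)
Lemma pseries_diffs_binomial_coef beta :
  pseries_diffs (binomial_coef beta) = beta *: binomial_coef (beta + 1).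
Proof.
apply/funext => j; rewrite /pseries_diffs /binomial_coef pochSl factS natrM.
rewrite -[RHS]/(beta * (poch (beta + 1) j / j`!%:R)) invfM.
by rewrite [RHS]mulrA mulrCA mulVKf.
Qed.

Lemma cvg_shifted_ratio (s : R) :
  (fun n : nat => (s + n%:R) / n.+1%:R) @ \oo --> (1 : R).
Proof.
have -> : (fun n : nat => (s + n%:R) / n.+1%:R)
    = (fun n => 1 + (s - 1) * (@harmonic R n)).
  apply/funext => n; rewrite /harmonic /=.
  have n1 : n.+1%:R != 0 :> R by [].
  by apply: (mulIf n1); rewrite divfK// mulrDl mulfVK// -natr1; ring.
rewrite -[X in _ --> X](_ : 1 + (s - 1) * 0 = 1); last by rewrite mulr0 addr0.
by apply: cvgD; [exact: cvg_cst|apply: cvgM; [exact: cvg_cst|exact: cvg_harmonic]].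
Qed.

Lemma is_cvg_binomial_series beta x :
  `|x| < 1 -> cvgn (pseries (binomial_coef beta) x).
Proof.
move=> x1.
apply: (@summable_of_cvg_ratio _ _ (fun n => (beta + n%:R) / n.+1%:R * x) x).
- by [].
- by move=> n; rewrite /= binomial_coefS exprS; ring.
- rewrite -[X in _ --> X]mul1r.
  by apply: cvgM; [exact: cvg_shifted_ratio|exact: cvg_cst].
Qed.

Definition binomial_sum beta x : R := limn (pseries (binomial_coef beta) x).

Lemma pseriesZ beta (f : nat -> R) x :
  pseries (beta *: f) x = beta *: pseries f x.
Proof.
apply/funext => N; rewrite /pseries /series /=.
rewrite [RHS]mulr_sumr; apply: eq_bigr => i _.
by rewrite mulrA.
Qed.

(** Termwise differentiation needs the series and its first two derived series to converge at a
    point of larger modulus; [(|x| + 1) / 2] serves, each derived series being a multiple of a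
    binomial series with shifted parameter. *)
Lemma is_derive_binomial_sum beta x : `|x| < 1 ->
  is_derive x 1 (binomial_sum beta) (beta * binomial_sum (beta + 1) x).
Proof.
move=> x1.
have K1 : `|(`|x| + 1) / 2| < 1 :> R.
  by rewrite ger0_norm; have := normr_ge0 x; lra.
have C b := @is_cvg_binomial_series b _ K1.
have -> : beta * binomial_sum (beta + 1) x
    = limn (pseries (pseries_diffs (binomial_coef beta)) x).
  rewrite pseries_diffs_binomial_coef pseriesZ limZl_tmp//.
  exact: is_cvg_binomial_series.
apply: (@pseries_snd_diffs _ _ ((`|x| + 1) / 2)) => //.
- rewrite pseries_diffs_binomial_coef pseriesZ.
  by apply: is_cvgZl_tmp; exact: C.
- rewrite pseries_diffs_binomial_coef.
  have -> : pseries_diffs (beta *: binomial_coef (beta + 1))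
      = beta *: pseries_diffs (binomial_coef (beta + 1)).
    by apply/funext => j; rewrite /pseries_diffs /= mulrCA.
  rewrite pseries_diffs_binomial_coef !pseriesZ.
  by apply: is_cvgZl_tmp; apply: is_cvgZl_tmp; exact: C.
- by rewrite [ltRHS]ger0_norm; have := normr_ge0 x; lra.
Qed.

(** This is the differential equation [(1 - x) f' = beta f]; on coefficients it reads
    [(j+1) b_(j+1) = (beta + j) b_j]. *)
Lemma binomial_sumS beta x : `|x| < 1 ->
  (1 - x) * (beta * binomial_sum (beta + 1) x) = beta * binomial_sum beta x.
Proof.
move=> x1.
have C b := @is_cvg_binomial_series b _ x1.
have Cd : cvgn (pseries (pseries_diffs (binomial_coef beta)) x).
  rewrite pseries_diffs_binomial_coef pseriesZ.
  by apply: is_cvgZl_tmp; exact: C.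
have := @pseries_diffs_equiv _ _ _ Cd; cbv zeta => Cs.
have D : beta * binomial_sum (beta + 1) x
    = limn (pseries (pseries_diffs (binomial_coef beta)) x).
  by rewrite pseries_diffs_binomial_coef pseriesZ limZl_tmp.
rewrite D mulrBl mul1r.
(* Both sides are limits of this one series; [Cs] supplies the convergence of the part multiplied by
   [x]. *)
apply: (@cvg_unique _ _ (series (fun j => beta * (binomial_coef beta j * x ^+ j)) @ \oo)) => //.
- rewrite (_ : series _ = (fun N => pseries (pseries_diffs (binomial_coef beta)) x N
     - x * series (fun i => i%:R * binomial_coef beta i * x ^+ i.-1) N)).
    by apply: cvgB => //; apply: cvgM => //; exact: cvg_cst.
  apply/funext => N; rewrite /pseries /series /= mulr_sumr -sumrB.
  apply: eq_bigr => i _; rewrite /pseries_diffs binomial_coefS.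
  rewrite [X in X * x ^+ i - _](_ : _ = (beta + i%:R) * binomial_coef beta i); last first.
    by rewrite mulrA [_.+1%:R * _]mulrC mulfVK.
  case: i => [|i]; first by rewrite /= expr0; ring.
  by rewrite /= exprS; ring.
- rewrite (_ : series _ = (fun N => beta * pseries (binomial_coef beta) x N)).
    by apply: cvgM; [exact: cvg_cst|exact: C].
  by apply/funext => N; rewrite /pseries /series /= mulr_sumr.
Qed.

Lemma binomial_sum0 beta : binomial_sum beta 0 = 1.
Proof.
apply/cvg_lim => //; apply: cvg_near_cst; near=> N.
have N0 : (0 < N)%N by near: N; exists 1%N.
rewrite /pseries /series /= (bigD1_seq 0) ?mem_index_iota ?iota_uniq //=.
rewrite /binomial_coef poch0 fact0 expr0 divr1 mulr1 big1 ?addr0// => i i0.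
by rewrite expr0n (negbTE i0) mulr0.
Unshelve. all: by end_near. Qed.

(** By the differential equation the product has derivative 0, so the mean value theorem makes it
    equal to its value 1 at 0. *)
Lemma binomial_sumE beta x :
  0 <= x < 1 -> binomial_sum beta x * (1 - x) `^ beta = 1.
Proof.
move=> /andP[x0 x1].
pose g y : R := binomial_sum beta y * (1 - y) `^ beta.
have dg (y : R) : `|y| < 1 -> is_derive y (1 : R) g (0 : R).
  move=> y1.
  have y1' : 0 < 1 - y by have := ler_norm y; lra.
  have d1 := @is_derive_binomial_sum beta y y1.
  have d2 : is_derive y (1 : R) (fun z : R => (1 - z) `^ beta)
      (- (beta * (1 - y) `^ (beta - 1))).
    have d3 : is_derive y (1 : R) (fun z : R => 1 - z) (-1).
      rewrite -[X in is_derive _ _ _ X](add0r (-1)).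
      by apply: is_deriveB.
    have d4 := @is_derive1_powR _ beta (1 - y) y1'.
    have := @is_derive1_comp _ (fun z => z `^ beta) (fun z => 1 - z) y _ _ d4 d3.
    by rewrite mulrN1.
  have := @is_deriveM _ _ _ _ _ _ _ _ d1 d2.
  rewrite /g => dd; apply: (is_derive_eq dd).
  (* Splitting off [1 - y] gives both terms of the product rule the same power and exposes the left
     side of [binomial_sumS]. *)
  have -> : (1 - y) `^ beta = (1 - y) `^ (beta - 1) * (1 - y).
    rewrite -[X in _ = _ * X](powRr1 (ltW y1')) -powRD ?subrK//.
    by rewrite (gt_eqF y1') implybT.
  have := @binomial_sumS beta y y1.
  rewrite /GRing.scale /= => Eq.
  rewrite -[LHS]/(binomial_sum beta y * _ + (_ * (1 - y)) * (beta * binomial_sum (beta + 1) y)).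
  by rewrite -mulrA Eq; ring.
have g0 : g 0 = 1 by rewrite /g binomial_sum0 subr0 powR1 mulr1.
rewrite -[RHS]g0.
have [->//|xn0] := eqVneq x 0.
have x_gt0 : 0 < x by rewrite lt_def xn0.
have xI (y : R) : 0 <= y <= x -> `|y| < 1.
  by move=> /andP[y0 yx]; rewrite ger0_norm// (le_lt_trans yx).
have [y /itvP yx||y _] := @MVT _ g (fun=> 0) 0 x x_gt0.
- by apply: dg; apply: xI; rewrite !yx.
- apply: derivable_within_continuous => y' /itvP yx.
  by apply: ex_derive; apply: dg; apply: xI; rewrite !yx.
- by rewrite mul0r => /eqP; rewrite subr_eq0 => /eqP.
Qed.

End BinomialSeries.

(** * Meixner polynomials and their recurrence *)

Section Hyperbolic.
Variables (R : realType) (a : R).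

Lemma cosh2_sub_sinh2 : cosh a ^+ 2 - sinh a ^+ 2 = 1.
Proof.
have H : expR a * expR (- a) = 1 by rewrite expRN divff// gt_eqF ?expR_gt0.
rewrite /cosh /sinh.
by rewrite -[RHS]H; field.
Qed.

Lemma sg_sinh : Num.sg (sinh a) = Num.sg a.
Proof.
rewrite /sinh sgrM [X in _ * X]gtr0_sg ?invr_gt0// mulr1.
have [a0|a0|->] := ltgtP a 0.
- by rewrite [RHS]ltr0_sg// ltr0_sg// subr_lt0 ltr_expR; lra.
- by rewrite [RHS]gtr0_sg// gtr0_sg// subr_gt0 ltr_expR; lra.
- by rewrite oppr0 subrr.
Qed.

Hypothesis ha : a != 0.

Lemma sinh_neq0 : sinh a != 0.
Proof. by rewrite -sgr_eq0 sg_sinh sgr_eq0. Qed.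

Lemma cosh_gt1 : 1 < cosh a.
Proof.
have c0 : 0 < cosh a by rewrite /cosh divr_gt0// addr_gt0// expR_gt0.
rewrite -(@ltr_pXn2r _ 2) ?nnegrE// ?(ltW c0)// expr1n.
have := cosh2_sub_sinh2; have : 0 < sinh a ^+ 2.
  by rewrite exprn_even_gt0//= sinh_neq0.
lra.
Qed.

(** This is tanh(a/2), the square root of [meixner_c a] with the sign of [a]. *)
Definition tanh_half : R := (cosh a - 1) / sinh a.

(** Since [sinh^2 = (cosh - 1) (cosh + 1)]; in this form [0 < c < 1] is visible. *)
Lemma meixner_cE : meixner_c a = (cosh a - 1) / (cosh a + 1).
Proof.
have := cosh_gt1; have := cosh2_sub_sinh2; have := sinh_neq0.
rewrite /meixner_c; set s := sinh a; set h := cosh a => s0 hs h1.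
have h10 : h + 1 != 0 by rewrite gt_eqF//; lra.
have h10' : h - 1 != 0 by rewrite gt_eqF//; lra.
rewrite expr_div_n.
have -> : s ^+ 2 = (h - 1) * (h + 1) by move: hs; lra.
by field; rewrite h10.
Qed.

Lemma meixner_c_gt0 : 0 < meixner_c a.
Proof. by rewrite meixner_cE divr_gt0//; have := cosh_gt1; lra. Qed.

Lemma meixner_c_lt1 : meixner_c a < 1.
Proof. by rewrite meixner_cE ltr_pdivrMr; have := cosh_gt1; lra. Qed.

Lemma sg_sqrt_meixner_c : Num.sg a * Num.sqrt (meixner_c a) = tanh_half.
Proof.
rewrite /meixner_c sqrtr_sqr -/tanh_half -sg_sinh.
have -> : Num.sg (sinh a) = Num.sg tanh_half.
  have h1 : 0 < cosh a - 1 by have := cosh_gt1; lra.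
  by rewrite /tanh_half [RHS]sgrM sgrV (gtr0_sg h1) mul1r.
by rewrite -numEsg.
Qed.

Lemma tanh_half_neq0 : tanh_half != 0.
Proof.
rewrite /tanh_half mulf_neq0 ?invr_eq0 ?sinh_neq0//.
by rewrite gt_eqF//; have := cosh_gt1; lra.
Qed.

Lemma sinh_tanh_half : sinh a * tanh_half = cosh a - 1.
Proof. by rewrite /tanh_half mulrC divfK// sinh_neq0. Qed.

Lemma sinh_div_tanh_half : sinh a / tanh_half = cosh a + 1.
Proof.
apply: (mulIf tanh_half_neq0); rewrite divfK ?tanh_half_neq0//.
apply: (mulIf sinh_neq0); rewrite -[RHS]mulrA [tanh_half * _]mulrC.
rewrite sinh_tanh_half; have := cosh2_sub_sinh2; lra.
Qed.

End Hyperbolic.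

Section Meixner.
Variables (R : realType) (beta a : R).
Hypotheses (hbeta : 0 < beta) (ha : a != 0).

Local Notation c := (meixner_c a).
Local Notation z := (1 - c^-1).

(** The added terms vanish because [(-j)_i] has a zero factor for [i > j]. A common range then makes
    the self-duality a termwise symmetry. *)
Lemma meixner_widen (N j : nat) (x : R) : (j < N)%N ->
  meixner beta a j x
  = \sum_(i < N) poch (- x) i * poch (- j%:R) i / (poch beta i * (i`!)%:R) * z ^+ i.
Proof.
move=> jN; rewrite /meixner.
rewrite -!(big_mkord xpredT (fun i => poch (- x) i * poch (- j%:R) i / (poch beta i * (i`!)%:R) * z ^+ i)).
rewrite [RHS](big_cat_nat _ jN)//= [X in _ = _ + X]big_nat_cond [X in _ = _ + X]big1 ?addr0//.
by move=> i /andP[/andP[ji _] _]; rewrite (poch_oppn_eq0 _ ji) mulr0 !mul0r.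
Qed.

Lemma meixner_selfdual (j k : nat) :
  meixner beta a j k%:R = meixner beta a k j%:R.
Proof.
rewrite (@meixner_widen (maxn j k).+1 j) ?ltnS ?leq_maxl//.
rewrite (@meixner_widen (maxn j k).+1 k) ?ltnS ?leq_maxr//.
by apply: eq_bigr => i _; rewrite [poch (- k%:R) i * _]mulrC.
Qed.

Lemma meixner0 (x : R) : meixner beta a 0 x = 1.
Proof. by rewrite /meixner big_ord1 !poch0 fact0 expr0 !mulr1 divr1. Qed.

(* Termwise the two sides differ by [g i - g i.+1], with [g 0 = 0] and
   [g j.+1 = 0] because of the factor [(-j)_(j+1)]. *)
Lemma meixner_difference (j : nat) (x : R) :
  z * j%:R * meixner beta a j x
  = (x + beta) * (meixner beta a j (x + 1) - meixner beta a j x)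
    - x * c^-1 * (meixner beta a j x - meixner beta a j (x - 1)).
Proof.
pose q i := poch (- j%:R) i / (poch beta i * (i`!)%:R) * z ^+ i.
pose g i := if i is i'.+1 then
  q i * (beta + i'%:R) * i'.+1%:R * poch (- x) i' else 0.
have qS i : q i.+1 * (beta + i%:R) * i.+1%:R = q i * (- j%:R + i%:R) * z.
  have b0 : beta + i%:R != 0 by rewrite gt_eqF// ltr_wpDr.
  have p0 : poch beta i != 0 by rewrite gt_eqF// poch_gt0.
  have f0 : i`!%:R != 0 :> R by rewrite pnatr_eq0 -lt0n fact_gt0.
  have i0 : i.+1%:R != 0 :> R by [].
  rewrite /q pochS pochS factS natrM exprS.
  move: b0 p0 f0 i0 (z ^+ i) (z) (poch (- j%:R) i) (- j%:R + i%:R).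
  generalize (beta + i%:R) (poch beta i) (i`!%:R : R) (i.+1%:R : R).
  move=> u1 u2 u3 u4 n1 n2 n3 n4 u5 u6 u7 u8.
  by field; rewrite n1 n2 n3 n4.
have ME y : meixner beta a j y = \sum_(i < j.+1) poch (- y) i * q i.
  by rewrite /meixner; apply: eq_bigr => i _; rewrite /q !mulrA.
have gj : g j.+1 = 0 by rewrite /g /q poch_oppn_eq0// !mul0r.
apply/eqP; rewrite -subr_eq0 !ME; apply/eqP.
have : \sum_(i < j.+1) (g i - g i.+1) = 0.
  rewrite -(big_mkord xpredT (fun i => g i - g i.+1)).
  under eq_bigr do rewrite -opprB.
  by rewrite sumrN telescope_sumr// gj /g subr0 oppr0.
move=> g_sum; rewrite -[RHS]g_sum.
rewrite !mulrBr !mulr_sumr -!sumrB; apply: eq_bigr => i _.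
have gS : g i.+1 = q i * (- j%:R + i%:R) * z * poch (- x) i by rewrite /g qS.
(* Splitting off the first or the last factor of [(-x)_(i+1)] removes the shift of the argument. *)
have pm : x * poch (- (x - 1)) i = (x - i%:R) * poch (- x) i.
  have := pochSl (- x) i; rewrite pochS.
  have -> : - x + 1 = - (x - 1) by ring.
  by move=> E; apply: oppr_inj; rewrite -mulNr -E; ring.
have -> : x * c^-1 * (poch (- (x - 1)) i * q i)
    = c^-1 * ((x - i%:R) * poch (- x) i) * q i by rewrite -pm; ring.
rewrite gS; case: (nat_of_ord i) => [|m].
  by rewrite /g !poch0; ring.
have pp : poch (- (x + 1)) m.+1 = - (x + 1) * poch (- x) m.
  by rewrite pochSl; congr (_ * poch _ _); ring.
rewrite /g pp pochS -!natr1; ring.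
Qed.

(** Self-duality turns the difference equation in the variable into a recurrence in the degree. At
    [k = 0] the term with [k.-1] has coefficient 0. *)
Lemma meixner_recurrence (j k : nat) :
  z * j%:R * meixner beta a k j%:R
  = (k%:R + beta) * (meixner beta a k.+1 j%:R - meixner beta a k j%:R)
    - k%:R * c^-1 * (meixner beta a k j%:R - meixner beta a k.-1 j%:R).
Proof.
rewrite -!(meixner_selfdual j) meixner_difference natr1.
case: k => [|k]; first by rewrite !mul0r.
by rewrite -(natr1 k) addrK.
Qed.

Local Notation t := (tanh_half a).

Lemma meixner_weight_gt0 j : 0 < meixner_weight beta a j.
Proof.
by rewrite /meixner_weight mulr_gt0 ?divr_gt0 ?poch_gt0 ?ltr0n ?fact_gt0// exprn_gt0// meixner_c_gt0.
Qed.

Lemma meixner_weightE j :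
  meixner_weight beta a j = binomial_coef beta j * c ^+ j.
Proof. by []. Qed.

Lemma sqrt_weight2 j : sqrt_weight beta a j ^+ 2 = meixner_weight beta a j.
Proof.
rewrite /sqrt_weight exprMn sqr_sqrtr ?ltW ?meixner_weight_gt0//.
by rewrite -exprM mulnC exprM sqr_sg ha expr1n mul1r.
Qed.

Lemma sqrt_weight_neq0 j : sqrt_weight beta a j != 0.
Proof.
by rewrite -sqrf_eq0 sqrt_weight2 gt_eqF// meixner_weight_gt0.
Qed.

Lemma sqrt_weight0 : sqrt_weight beta a 0 = 1.
Proof.
by rewrite /sqrt_weight /meixner_weight poch0 fact0 !expr0 divr1 mul1r mulr1 sqrtr1.
Qed.

(** The new sign factor and the new square root of [c] combine to the signed root [t]. *)
Lemma sqrt_weightS j : sqrt_weight beta a j.+1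
  = t * Num.sqrt ((beta + j%:R) / j.+1%:R) * sqrt_weight beta a j.
Proof.
rewrite /sqrt_weight !meixner_weightE binomial_coefS !exprS -sg_sqrt_meixner_c//.
have -> : (beta + j%:R) / j.+1%:R * binomial_coef beta j * (c * c ^+ j)
  = c * ((beta + j%:R) / j.+1%:R * (binomial_coef beta j * c ^+ j)) by ring.
have q0 : 0 <= (beta + j%:R) / j.+1%:R by rewrite divr_ge0// addr_ge0// ltW.
rewrite (@sqrtrM _ c _ (ltW (meixner_c_gt0 ha))) (@sqrtrM _ _ _ q0); ring.
Qed.

(** Because [1 / h_k = (1-c)^beta * w_k]; together with self-duality this makes the transition
    matrix symmetric. *)
Lemma invsqrt_sqnormE k : invsqrt_sqnorm beta a k
  = Num.sqrt ((1 - c) `^ beta) * sqrt_weight beta a k.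
Proof.
rewrite /invsqrt_sqnorm /sqrt_weight /meixner_sqnorm mulrCA; congr (_ * _).
rewrite -sqrtrM ?powR_ge0//; congr Num.sqrt.
by rewrite invf_div /meixner_weight; ring.
Qed.

Definition transition (k j : nat) : R :=
  meixner beta a k j%:R * invsqrt_sqnorm beta a k * sqrt_weight beta a j.

Lemma transition_sym k j : transition k j = transition j k.
Proof. by rewrite /transition !invsqrt_sqnormE meixner_selfdual; ring. Qed.

Lemma rho_plus_gt0 k : 0 < rho_plus beta k.
Proof. by rewrite /rho_plus sqrtr_gt0 natr1 mulr_gt0// ltr_wpDr. Qed.

Definition jac_off k : R := - (sinh a / 2) * rho_plus beta k.
Definition jac_diag k : R := cosh a * lambda beta k.

Lemma jac_off_neq0 k : jac_off k != 0.
Proof.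
apply: mulf_neq0; last by rewrite gt_eqF// rho_plus_gt0.
rewrite oppr_eq0; apply: mulf_neq0; first exact: sinh_neq0.
by rewrite invr_eq0.
Qed.

End Meixner.

(** The symmetric tridiagonal operator with diagonal [q] and off-diagonal [p], on arbitrary
    sequences. The ring is general because it serves over the reals for the limits and over the
    complex numbers for the blocks. *)
Definition jacobi (F : pzRingType) (p q : nat -> F) (v : nat -> F) (k : nat) : F :=
  p k * v k.+1 + q k * v k + (if k is k'.+1 then p k' * v k' else 0).

Section Eigen.
Variables (R : realType) (beta a : R).
Hypotheses (hbeta : 0 < beta) (ha : a != 0).

Local Notation c := (meixner_c a).
Local Notation t := (tanh_half a).
Local Notation U := (transition beta a).

(** The square roots of [(k+1)(beta+k)] and [(beta+k)/(k+1)] multiply to [beta + k], so [rho_plus]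
    leaves no root behind. *)
Lemma rho_plus_sqrt_weight k : rho_plus beta k * sqrt_weight beta a k.+1
  = t * (beta + k%:R) * sqrt_weight beta a k.
Proof.
rewrite sqrt_weightS//.
have -> : rho_plus beta k * (t * Num.sqrt ((beta + k%:R) / k.+1%:R) * sqrt_weight beta a k)
  = (rho_plus beta k * Num.sqrt ((beta + k%:R) / k.+1%:R)) * t * sqrt_weight beta a k by ring.
rewrite /rho_plus -sqrtrM; last by rewrite mulr_ge0// ?addr_ge0// ltW.
have -> : (k%:R + 1) * (beta + k%:R) * ((beta + k%:R) / k.+1%:R) = (beta + k%:R) ^+ 2.
  by rewrite natr1 mulrACA [_ * (beta + _)]mulrC -mulrA; field.
by rewrite sqrtr_sqr ger0_norm ?addr_ge0// ?ltW//; ring.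
Qed.

Lemma sqrt_weight_rho_plus k : rho_plus beta k * sqrt_weight beta a k
  = k.+1%:R / t * sqrt_weight beta a k.+1.
Proof.
have r0 : rho_plus beta k != 0.
  by rewrite gt_eqF// rho_plus_gt0.
have t0 := tanh_half_neq0 ha.
apply: (mulfI r0); apply: (mulfI t0).
have -> : t * (rho_plus beta k * (k.+1%:R / t * sqrt_weight beta a k.+1))
  = k.+1%:R * (rho_plus beta k * sqrt_weight beta a k.+1) by field.
rewrite rho_plus_sqrt_weight.
have -> : t * (rho_plus beta k * (rho_plus beta k * sqrt_weight beta a k))
  = t * rho_plus beta k ^+ 2 * sqrt_weight beta a k by ring.
rewrite {1}/rho_plus sqr_sqrtr; first by rewrite -natr1; ring.
by rewrite mulr_ge0// addr_ge0// ltW.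
Qed.

(** Once the weights are factored out, [sinh a * t = cosh a - 1] and [sinh a / t = cosh a + 1] make
    all coefficients rational in [cosh a], and the Meixner recurrence remains. *)
Lemma transition_eigen j k :
  jacobi (jac_off beta a) (jac_diag beta a) (U ^~ j) k = lambda beta j * U k j.
Proof.
pose S : R := Num.sqrt ((1 - c) `^ beta) * sqrt_weight beta a j.
have UE m : U m j = meixner beta a m j%:R * sqrt_weight beta a m * S.
  by rewrite /transition invsqrt_sqnormE /S; ring.
have st := sinh_tanh_half ha; have sdt := sinh_div_tanh_half ha.
have E1 : jac_off beta a k * U k.+1 j = - ((cosh a - 1) / 2) * (beta + k%:R)
    * meixner beta a k.+1 j%:R * sqrt_weight beta a k * S.
  rewrite UE /jac_off -st.
  transitivity (- (sinh a / 2) * meixner beta a k.+1 j%:R * S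
    * (rho_plus beta k * sqrt_weight beta a k.+1)); first by ring.
  by rewrite rho_plus_sqrt_weight; ring.
have E2 : (if k is k'.+1 then jac_off beta a k' * U k' j else 0)
    = - ((cosh a + 1) / 2) * k%:R * meixner beta a k.-1 j%:R * sqrt_weight beta a k * S.
  case: k {E1} => [|k]; first by rewrite mulr0 !mul0r.
  rewrite UE /jac_off -sdt /=.
  transitivity (- (sinh a / 2) * meixner beta a k j%:R * S
    * (rho_plus beta k * sqrt_weight beta a k)); first by ring.
  by rewrite sqrt_weight_rho_plus; ring.
rewrite /jacobi E1 E2 UE.
have := @meixner_recurrence _ beta a hbeta j k.
rewrite meixner_cE// invf_div /jac_diag /lambda.
have := cosh_gt1 ha; set h := cosh a => h1.
have h0 : h - 1 != 0 by rewrite gt_eqF//; lra.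
move: (meixner beta a k.+1 _) (meixner beta a k _) (meixner beta a k.-1 _) => m1 m0 m2.
(* With [c = (h-1)/(h+1)] one has [1 - 1/c = -2/(h-1)], so this factor normalises the eigenvalue
   term to [j * m0]. *)
move=> /(congr1 (fun y => - (h - 1) / 2 * y)).
have -> : - (h - 1) / 2 * ((1 - (h + 1) / (h - 1)) * j%:R * m0) = j%:R * m0 by field.
move: (sqrt_weight beta a k) => sk E.
transitivity (beta / 2 * m0 * sk * S + (j%:R * m0) * sk * S); last by ring.
by rewrite E; field.
Qed.

End Eigen.

(** * Orthonormality of the transition coefficients *)

(** The diagonal cancels and the off-diagonal terms telescope; there is no boundary contribution at
    index 0. *)
Lemma jacobi_green (F : comNzRingType) (p q u v : nat -> F) (N : nat) :
  \sum_(m < N.+1) (jacobi p q u m * v m - u m * jacobi p q v m)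
  = p N * (u N.+1 * v N - u N * v N.+1).
Proof.
elim: N => [|N IH]; first by rewrite big_ord1 /jacobi /=; ring.
by rewrite big_ord_recr /= IH /jacobi /=; ring.
Qed.

(** * Rapidly decreasing sequences *)

Section RapidDecay.
Variable R : realType.
Implicit Types (f g : nat -> R) (x : R).

(** Decay faster than every power survives multiplication by the linearly growing [lambda] and
    [rho_plus], which mere convergence to 0 need not. *)
Definition rapid f := forall m : nat, (fun N : nat => N.+1%:R ^+ m * f N) @ \oo --> 0.

Lemma rapid_cvg0 f : rapid f -> f @ \oo --> 0.
Proof. by move=> /(_ 0%N); under eq_fun do rewrite expr0 mul1r. Qed.

Lemma rapidZ x f : rapid f -> rapid (fun N => x * f N).
Proof.
move=> rf m; under eq_fun do rewrite mulrCA.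
by rewrite -(mulr0 x); apply: cvgM; [exact: cvg_cst|exact: rf].
Qed.

Lemma rapidD f g : rapid f -> rapid g -> rapid (fun N => f N + g N).
Proof.
move=> rf rg m; under eq_fun do rewrite mulrDr.
by rewrite -(addr0 0); apply: cvgD; [exact: rf|exact: rg].
Qed.

Lemma rapidM f : rapid f -> rapid (fun N => N.+1%:R * f N).
Proof. by move=> rf m; under eq_fun do rewrite mulrA -exprSr; exact: rf. Qed.

End RapidDecay.

Section Orthonormal.
Variables (R : realType) (beta a : R).
Hypotheses (hbeta : 0 < beta) (ha : a != 0).

Local Notation c := (meixner_c a).
Local Notation t := (tanh_half a).
Local Notation U := (transition beta a).
Local Notation p := (jac_off beta a).
Local Notation q := (jac_diag beta a).

(** By symmetry the rows are eigenvectors just as the columns are. *)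
Lemma transition_row k : jacobi p q (U k) = (fun m => lambda beta k * U k m).
Proof.
have -> : U k = U ^~ k by apply/funext => m; rewrite transition_sym.
by apply/funext => m; rewrite transition_eigen.
Qed.

Lemma cvg_sqrt_ratio :
  (fun N : nat => Num.sqrt ((beta + N%:R) / N.+1%:R)) @ \oo --> (1 : R).
Proof.
rewrite -[X in _ --> X]sqrtr1; apply: continuous_cvg.
  exact: sqrt_continuous.
exact: cvg_shifted_ratio.
Qed.

Lemma tanh_half_lt1 : `|t| < 1.
Proof.
rewrite -(@ltr_pXn2r _ 2) ?nnegrE// expr1n real_normK ?num_real//.
exact: meixner_c_lt1.
Qed.

(** The ratio of consecutive terms tends to [t] whatever the power, and [|t| < 1]; hence the series
    converges and its terms tend to 0. *)
Lemma rapid_sqrt_weight : rapid (sqrt_weight beta a).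
Proof.
move=> m; apply: cvg_series_cvg_0.
apply: (@summable_of_cvg_ratio _ _ (fun N =>
  ((2 + N%:R) / N.+1%:R) ^+ m * (t * Num.sqrt ((beta + N%:R) / N.+1%:R))) t).
- exact: tanh_half_lt1.
- move=> N; rewrite sqrt_weightS// expr_div_n.
  have -> : 2 + N%:R = N.+2%:R :> R by rewrite -!natr1; ring.
  have N0 : N.+1%:R ^+ m != 0 :> R by rewrite expf_neq0.
  by field.
- rewrite -[X in _ --> X]mul1r; apply: cvgM; last first.
    by rewrite -[X in _ --> X]mulr1; apply: cvgM; [exact: cvg_cst|exact: cvg_sqrt_ratio].
  elim: m => [|m IH]; first by under eq_fun do rewrite expr0; exact: cvg_cst.
  rewrite -[X in _ --> X]mul1r; under eq_fun do rewrite exprS.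
  by apply: cvgM; [exact: cvg_shifted_ratio|exact: IH].
Qed.

Lemma transition0 m : U 0 m = Num.sqrt ((1 - c) `^ beta) * sqrt_weight beta a m.
Proof.
by rewrite /transition meixner0 invsqrt_sqnormE// sqrt_weight0// mulr1 mul1r.
Qed.

Lemma transitionS k m : U k.+1 m = (p k)^-1 *
  (lambda beta m * U k m - q k * U k m - (if k is k'.+1 then p k' * U k' m else 0)).
Proof.
rewrite -transition_eigen// /jacobi.
have p0 : p k != 0 by apply: jac_off_neq0.
by case: k p0 => [|k] p0; field.
Qed.

(** Row 0 is a multiple of [sqrt_weight], and each further row is obtained from the two before it
    with coefficients at most linear in [m]. The induction therefore carries two consecutive
    rows. *)
Lemma rapid_transition k : rapid (U k).
Proof.
suff : rapid (U k) /\ rapid (U k.+1) by case.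
have next i (f : nat -> R) : rapid f -> rapid (U i) ->
    (forall m, U i.+1 m = (p i)^-1 * (lambda beta m * U i m - q i * U i m - f m)) ->
    rapid (U i.+1).
  move=> rf rU UE.
  have -> : U i.+1 = (fun m => (p i)^-1 * ((m.+1%:R * U i m
      + (beta / 2 - 1 - q i) * U i m) + (-1) * f m)).
    by apply/funext => m; rewrite UE /lambda -natr1; ring.
  apply: rapidZ; apply: rapidD; last exact: rapidZ.
  by apply: rapidD; [exact: rapidM|exact: rapidZ].
elim: k => [|k [rk rSk]].
  have r0 : rapid (U 0).
    have -> : U 0 = (fun m => Num.sqrt ((1 - c) `^ beta) * sqrt_weight beta a m).
      by apply/funext => m; exact: transition0.
    exact/rapidZ/rapid_sqrt_weight.
  split => //; apply: (next _ (fun=> 0)) => //; last exact: transitionS.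
  by move=> m; under eq_fun do rewrite mulr0; exact: cvg_cst.
split => //; apply: (next _ (fun m => p k * U k m)) => //.
- exact: rapidZ.
- exact: transitionS.
Qed.

Lemma rho_plus_ratio N :
  rho_plus beta N = N.+1%:R * Num.sqrt ((beta + N%:R) / N.+1%:R).
Proof.
rewrite -{1}(ger0_norm (ler0n R N.+1)) -sqrtr_sqr -sqrtrM ?sqr_ge0//.
rewrite /rho_plus natr1; congr Num.sqrt.
by field.
Qed.

(** The linear growth of [p N] is absorbed by the rapid decay of one of the rows. *)
Lemma jac_boundary_cvg0 k l :
  (fun N => p N * (U k N.+1 * U l N - U k N * U l N.+1)) @ \oo --> 0.
Proof.
have H k' l' : (fun N => p N * (U k' N.+1 * U l' N)) @ \oo --> 0.
  have -> : (fun N => p N * (U k' N.+1 * U l' N))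
    = (fun N => - (sinh a / 2) * Num.sqrt ((beta + N%:R) / N.+1%:R)
        * (U k' N.+1 * (N.+1%:R ^+ 1 * U l' N))).
    by apply/funext => N; rewrite /jac_off rho_plus_ratio; ring.
  rewrite -[X in _ --> X](mulr0 (- (sinh a / 2) * 1)); apply: cvgM.
    by apply: cvgM; [exact: cvg_cst|exact: cvg_sqrt_ratio].
  rewrite -[X in _ --> X](mulr0 0); apply: cvgM; last exact: rapid_transition.
  by rewrite (cvg_shiftS (U k')); apply: rapid_cvg0; exact: rapid_transition.
have -> : (fun N => p N * (U k N.+1 * U l N - U k N * U l N.+1))
  = (fun N => p N * (U k N.+1 * U l N) - p N * (U l N.+1 * U k N)).
  by apply/funext => N; ring.
by rewrite -[X in _ --> X]subr0; apply: cvgB; exact: H.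
Qed.

Definition gram (k l N : nat) : R := \sum_(0 <= m < N) U k m * U l m.

(** Green's identity for two rows with distinct eigenvalues expresses the truncated product by the
    boundary term. *)
Lemma gram_offdiag k l : k != l -> gram k l @ \oo --> (0 : R).
Proof.
move=> kl; suff : (fun N => gram k l N.+1) @ \oo --> (0 : R) by rewrite cvg_shiftS.
have lkl : lambda beta k - lambda beta l != 0.
  rewrite /lambda opprD addrACA subrr add0r subr_eq0.
  by rewrite eqr_nat.
have -> : (fun N => gram k l N.+1) = (fun N => (lambda beta k - lambda beta l)^-1 *
    (p N * (U k N.+1 * U l N - U k N * U l N.+1))).
  apply/funext => N; rewrite -(@jacobi_green _ p q) !transition_row.
  rewrite /gram big_mkord mulr_sumr; apply: eq_bigr => m _; field.
  by [].
rewrite -[X in _ --> X](mulr0 (lambda beta k - lambda beta l)^-1).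
by apply: cvgM; [exact: cvg_cst|exact: jac_boundary_cvg0].
Qed.

Lemma gram_eigen k l N :
  \sum_(0 <= m < N) lambda beta m * U k m * U l m
  = p k * gram k.+1 l N + q k * gram k l N
    + (if k is k'.+1 then p k' * gram k' l N else 0).
Proof.
rewrite /gram; case: k => [|k]; rewrite ?mulr_sumr ?addr0 -!big_split /=;
  apply: eq_bigr => m _; rewrite -transition_eigen// /jacobi; ring.
Qed.

(** The truncated sum of [lambda m * U k m * U k.+1 m] is expanded by the recurrence of either row.
    Both squared norms appear with the factor [p k], and all other terms are off-diagonal. *)
Lemma gram_diagS k :
  (fun N => gram k.+1 k.+1 N - gram k k N) @ \oo --> 0.
Proof.
have gC i j N : gram i j N = gram j i N.
  by apply: eq_bigr => m _; rewrite mulrC.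
have p0 : p k != 0 by exact: jac_off_neq0.
pose f N := if k is k'.+1 then p k' * gram k' k.+1 N else 0.
have f0 : f @ \oo --> 0.
  rewrite /f; case: (k) => [|k']; first exact: cvg_cst.
  rewrite -(mulr0 (p k')); apply: cvgM; first exact: cvg_cst.
  by apply: gram_offdiag; rewrite ltn_eqF.
have -> : (fun N => gram k.+1 k.+1 N - gram k k N) = (fun N => (p k)^-1 *
    (p k.+1 * gram k.+2 k N + (q k.+1 - q k) * gram k.+1 k N - f N)).
  apply/funext => N; apply: (mulfI p0); rewrite mulVKf// mulrBr.
  have := gram_eigen k.+1 k N; have := gram_eigen k k.+1 N.
  rewrite -/(f N) /= (gC k k.+1).
  have -> : \sum_(0 <= m < N) lambda beta m * U k m * U k.+1 m
      = \sum_(0 <= m < N) lambda beta m * U k.+1 m * U k m.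
    by apply: eq_bigr => m _; ring.
  by move=> -> E; apply/eqP; rewrite -subr_eq0; apply/eqP; move: E => /eqP; rewrite -subr_eq0 => /eqP <-; ring.
rewrite -[X in _ --> X](mulr0 (p k)^-1); apply: cvgM; first exact: cvg_cst.
rewrite -[X in _ --> X]subr0; apply: cvgB => //.
rewrite -[X in _ --> X]addr0; apply: cvgD.
  rewrite -(mulr0 (p k.+1)); apply: cvgM; first exact: cvg_cst.
  by apply: gram_offdiag; rewrite gtn_eqF.
rewrite -(mulr0 (q k.+1 - q k)); apply: cvgM; first exact: cvg_cst.
by apply: gram_offdiag; rewrite gtn_eqF.
Qed.

Lemma gram_diag k : gram k k @ \oo --> (1 : R).
Proof.
have c0 := meixner_c_gt0 ha; have c1 := meixner_c_lt1 ha.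
elim: k => [|k IH].
  have -> : gram 0 0 = (fun N => (1 - c) `^ beta * pseries (binomial_coef beta) c N).
    apply/funext => N; rewrite /gram /pseries /series /= mulr_sumr.
    apply: eq_bigr => m _; rewrite !transition0 -expr2 exprMn sqr_sqrtr ?powR_ge0//.
    by rewrite sqrt_weight2.
  have := @binomial_sumE _ beta c; rewrite (ltW c0) c1 => /(_ isT).
  rewrite mulrC => sumE; rewrite -[X in _ --> X]sumE.
  apply: cvgM; first exact: cvg_cst.
  by apply: is_cvg_binomial_series; rewrite gtr0_norm.
have -> : gram k.+1 k.+1 = (fun N => (gram k.+1 k.+1 N - gram k k N) + gram k k N).
  by apply/funext => N; rewrite subrK.
by rewrite -[X in _ --> X]add0r; apply: cvgD => //; exact: gram_diagS.
Qed.

Lemma transition_orthonormal k l :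
  series (fun m => U k m * U l m) @ \oo --> ((k == l)%:R : R).
Proof.
by case: eqVneq => [->|kl]; [exact: gram_diag|exact: gram_offdiag].
Qed.

End Orthonormal.

(** * Matrix valued polynomials *)

(** The matrix factors into the coefficient matrix, triangular with the leading coefficients on its
    diagonal, and a Vandermonde matrix with distinct nodes. *)
Lemma unitmx_horner (F : fieldType) (n : nat) (P : 'I_n -> {poly F}) (x : 'I_n -> F) :
  (forall i, size (P i) = i.+1) -> injective x ->
  \matrix_(i, l) (P i).[x l] \in unitmx.
Proof.
move=> sP x_inj.
pose T : 'M[F]_n := \matrix_(i, s) (P i)`_s.
have -> : \matrix_(i, l) (P i).[x l] = T *m Vandermonde n (\row_l x l).
  apply/matrixP => i l; rewrite !mxE (@horner_coef_wide _ n) ?sP//.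
  by apply: eq_bigr => s _; rewrite !mxE.
rewrite unitmxE det_mulmx unitfE mulf_neq0//.
  rewrite det_trig.
    apply/prodf_neq0 => i _; rewrite mxE.
    have -> : (P i)`_i = lead_coef (P i) by rewrite /lead_coef sP.
    by rewrite lead_coef_eq0 -size_poly_eq0 sP.
  by apply/is_trig_mxP => i l il; rewrite mxE nth_default// sP.
rewrite det_Vandermonde; apply/prodf_neq0 => i _; apply/prodf_neq0 => l il.
by rewrite !mxE subr_eq0; apply: contraTneq il => /x_inj ->; rewrite ltnn.
Qed.

Section MeixnerPolynomial.
Variables (R : realType) (beta a : R).
Hypotheses (hbeta : 0 < beta) (ha : a != 0).

(** The Pochhammer symbol [(-x)_s] as a polynomial in [x], used to read off the degrees of the
    Meixner polynomials. *)
Definition poch_poly (s : nat) : {poly R} := \prod_(m < s) (m%:R%:P - 'X).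

Lemma horner_poch_poly s x : (poch_poly s).[x] = poch (- x) s.
Proof.
rewrite /poch_poly horner_prod; apply: eq_bigr => m _.
by rewrite hornerD hornerN hornerC hornerX addrC.
Qed.

Lemma size_poch_poly s : size (poch_poly s) = s.+1.
Proof.
elim: s => [|s IH]; first by rewrite /poch_poly big_ord0 size_poly1.
have s2 : size ((s%:R)%:P - 'X : {poly R}) = 2.
  by rewrite -opprB size_polyN size_XsubC.
rewrite /poch_poly big_ord_recr /= -/(poch_poly s) size_mul ?IH ?s2 ?addn2//.
  by rewrite -size_poly_eq0 IH.
by rewrite -size_poly_eq0 s2.
Qed.

Definition meixner_coef (k i : nat) : R :=
  poch (- k%:R) i / (poch beta i * (i`!)%:R) * (1 - (meixner_c a)^-1) ^+ i.

Lemma meixner_coef_neq0 k : meixner_coef k k != 0.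
Proof.
rewrite /meixner_coef; apply: mulf_neq0; first apply: mulf_neq0.
- apply/prodf_neq0 => i _; rewrite addrC subr_eq0 eqr_nat.
  by rewrite ltn_eqF.
- rewrite invr_eq0; apply: mulf_neq0; first by rewrite gt_eqF// poch_gt0.
  by rewrite pnatr_eq0 -lt0n fact_gt0.
- apply: expf_neq0; rewrite subr_eq0 eq_sym invr_eq1 lt_eqF//.
  exact: meixner_c_lt1.
Qed.

Definition meixner_poly (k : nat) : {poly R} :=
  \sum_(i < k.+1) meixner_coef k i *: poch_poly i.

Lemma horner_meixner_poly k x : (meixner_poly k).[x] = meixner beta a k x.
Proof.
rewrite /meixner_poly horner_sum; apply: eq_bigr => i _.
by rewrite hornerZ horner_poch_poly /meixner_coef; ring.
Qed.

Lemma size_meixner_poly k : size (meixner_poly k) = k.+1.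
Proof.
have sk : size (meixner_coef k k *: poch_poly k) = k.+1.
  by rewrite size_scale ?meixner_coef_neq0// size_poch_poly.
rewrite /meixner_poly big_ord_recr /= addrC size_polyDl sk// ltnS.
apply: (leq_trans (size_sum _ _ _)); apply/bigmax_leqP => i _.
by rewrite (leq_trans (size_scale_leq _ _))// size_poch_poly.
Qed.

End MeixnerPolynomial.

(** * Real numbers inside the complex numbers *)

Section RealInComplex.
Variable R : realType.
Local Notation C := (Cplx R).

Lemma toC0 : toC (0 : R) = 0. Proof. by []. Qed.
Lemma toCD (x y : R) : toC (x + y) = toC x + toC y.
Proof. exact: (rmorphD (real_complex R)). Qed.
Lemma toCN (x : R) : toC (- x) = - toC x.
Proof. exact: (rmorphN (real_complex R)). Qed.
Lemma toCM (x y : R) : toC (x * y) = toC x * toC y.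
Proof. exact: (rmorphM (real_complex R)). Qed.
Lemma toCX (x : R) m : toC (x ^+ m) = toC x ^+ m.
Proof. exact: (rmorphXn (real_complex R)). Qed.
Lemma toC_sum (I : Type) (r : seq I) (P : pred I) (f : I -> R) :
  toC (\sum_(i <- r | P i) f i) = \sum_(i <- r | P i) toC (f i).
Proof. exact: (rmorph_sum (real_complex R)). Qed.
Lemma toC_eq0 (x : R) : (toC x == 0) = (x == 0).
Proof. exact: (fmorph_eq0 (real_complex R)). Qed.
Lemma toC_real (x : R) : toC x \is Num.real.
Proof. by apply/complex_realP; exists x. Qed.
Lemma conj_toC (x : R) : Num.conj (toC x) = toC x.
Proof. by apply: conj_Creal; exact: toC_real. Qed.
Lemma norm_toC (x : R) : `|toC x| = toC `|x|.
Proof.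
rewrite normc_def /= expr0n addr0 sqrtr_sqr//.
Qed.
Lemma lt_toC (x y : R) : (toC x < toC y) = (x < y).
Proof. exact: ltcR. Qed.

Lemma cvg_mx_toC (n : nat) (F : nat -> 'M[C]_n) (L : 'M[C]_n)
    (f : 'I_n -> 'I_n -> nat -> R) (l : 'I_n -> 'I_n -> R) :
  (forall N i j, F N i j = toC (f i j N)) -> (forall i j, L i j = toC (l i j)) ->
  (forall i j, f i j @ \oo --> l i j) -> F @ \oo --> L.
Proof.
move=> FE LE fl; apply/cvg_ballP => e e0.
(* In the order of the complex numbers a positive element is real. *)
have [x ex] : exists x, e = toC x.
  by have /complex_realP[x ->] := gtr0_real e0; exists x.
have x0 : 0 < x by move: e0; rewrite ex -toC0 lt_toC.
have : \forall N \near \oo, forall i j, `|l i j - f i j N| < x.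
  apply: filter_forall => i; apply: filter_forall => j.
  by move/cvgrPdist_lt: (fl i j); apply.
apply: filterS => N H; split => // i j.
rewrite -ball_normE /= FE LE -toCN -toCD norm_toC ex lt_toC.
exact: H.
Qed.

End RealInComplex.

(** * Powers of a Jacobi operator *)

Section JacobiPowers.
Variables (F : numDomainType) (p q : nat -> F).
Local Notation J := (jacobi p q).
Implicit Types u v : nat -> F.

Definition delta (k : nat) : nat -> F := fun m => (m == k)%:R.

(** Green's identity moves one factor at a time; the boundary terms vanish because the support of
    [u], growing by one at each step, stays inside the summation range. *)
Lemma iter_jacobi_adjoint n u v N M : (forall m, (N <= m)%N -> u m = 0) ->
  (N + n <= M)%N ->
  \sum_(m < M) iter n J u m * v m = \sum_(m < M) u m * iter n J v m.
Proof.
elim: n u N => [//|n IH] u N uN NM.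
rewrite iterSr (IH _ N.+1); last 2 first.
- case=> // m; rewrite ltnS => Nm.
  by rewrite /jacobi !uN ?(leqW (leqW Nm)) ?(leqW Nm)// !mulr0 !addr0.
- by rewrite addSn -addnS.
clear IH; case: M NM => [|M NM]; first by rewrite addnS ltn0.
have NM' : (N <= M)%N by rewrite -ltnS (leq_trans _ NM)// addnS ltnS leq_addr.
apply/eqP; rewrite -subr_eq0 -sumrB jacobi_green !uN ?(leqW NM')//.
by rewrite !mul0r subrr mulr0.
Qed.

Lemma sum_delta M k v : (k < M)%N -> \sum_(m < M) delta k m * v m = v k.
Proof.
move=> kM; rewrite (bigD1 (Ordinal kM))//= /delta eqxx mul1r big1 ?addr0// => i ik.
have : val i != k by apply: contra ik => /eqP ik; apply/eqP/val_inj.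
by move/negPf => /= ->; rewrite mul0r.
Qed.

Lemma iter_jacobi_delta n k v M : (k + n < M)%N ->
  \sum_(m < M) iter n J (delta k) m * v m = iter n J v k.
Proof.
move=> kM; rewrite (@iter_jacobi_adjoint _ _ _ k.+1).
- by rewrite sum_delta// (leq_ltn_trans _ kM)// leq_addr.
- by move=> m km; rewrite /delta gtn_eqF.
- by rewrite addSn.
Qed.

Lemma iter_jacobi_sym n k l : iter n J (delta k) l = iter n J (delta l) k.
Proof.
rewrite -(@iter_jacobi_delta n k (delta l) (k + n + l).+1) ?ltnS ?leq_addr//.
rewrite (eq_bigr (fun m : 'I__ => delta l m * iter n J (delta k) m)) => [|m _]; last exact: mulrC.
by rewrite sum_delta// ltnS leq_addl.
Qed.

Lemma iter_jacobi_real n v : (forall m, p m \is Num.real) ->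
  (forall m, q m \is Num.real) -> (forall m, v m \is Num.real) ->
  forall m, iter n J v m \is Num.real.
Proof.
move=> pR qR vR; elim: n => [//|n IH] m; rewrite iterS {1}/jacobi.
by apply: realD; [apply: realD; exact: realM|case: m => // m; exact: realM].
Qed.

Lemma iter_jacobi_gt n k m : (k + n < m)%N -> iter n J (delta k) m = 0.
Proof.
elim: n m => [|n IH] m km; first by rewrite /= /delta gtn_eqF// -(addn0 k).
rewrite iterS {1}/jacobi; case: m km => // m; rewrite addnS ltnS => km.
by rewrite !IH ?mulr0 ?addr0// ltnS ltnW// ltnW.
Qed.

(** The outermost entry of the band is a product of off-diagonal entries. *)
Lemma iter_jacobi_top n k : (forall m, p m != 0) ->
  iter n J (delta k) (k + n)%N != 0.
Proof.
move=> p0; elim: n => [|n IH]; first by rewrite addn0 /= /delta eqxx oner_eq0.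
rewrite addnS iterS {1}/jacobi (@iter_jacobi_gt n k (k + n).+2)//.
rewrite (@iter_jacobi_gt n k (k + n).+1)// !mulr0 !add0r.
exact: mulf_neq0.
Qed.

Lemma iter_jacobi_eigen n v x : J v =1 (fun m => x * v m) ->
  iter n J v =1 (fun m => x ^+ n * v m).
Proof.
move=> Jv; elim: n => [|n IH] m; first by rewrite expr0 mul1r.
rewrite iterS exprS -mulrA [x * _]mulrCA -Jv.
by rewrite /jacobi !IH; case: m => [|m]; rewrite ?IH; ring.
Qed.

End JacobiPowers.

Section ConjugateTranspose.
Variable C : numClosedFieldType.

Lemma adjmxM m n p (X : 'M[C]_(m, n)) (Y : 'M[C]_(n, p)) :
  (X *m Y)^t* = Y^t* *m X^t*.
Proof. by rewrite trmx_mul map_mxM. Qed.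

Lemma adjmxD m n (X Y : 'M[C]_(m, n)) : (X + Y)^t* = X^t* + Y^t*.
Proof. by rewrite linearD map_mxD. Qed.

Lemma adjmx0 m n : (0 : 'M[C]_(m, n))^t* = 0.
Proof. by rewrite trmx0 map_mx0. Qed.

End ConjugateTranspose.

(** * Indices split into blocks of length [n] *)

Section BlockIndex.
Variable n : nat.

Lemma block_indexE (k l : nat) (i r : 'I_n) :
  ((n * k + i == n * l + r) = (k == l) && (i == r))%N.
Proof.
have n0 : (0 < n)%N by rewrite (leq_ltn_trans _ (ltn_ord i)).
apply/eqP/andP => [E|[/eqP -> /eqP ->]//].
have := congr1 (fun m => m %/ n)%N E; have := congr1 (fun m => m %% n)%N E.
rewrite ![(n * _)%N]mulnC !modnMDl !divnMDl// !modn_small// !divn_small// !addn0.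
by move=> ir ->; split => //; apply/eqP/val_inj.
Qed.

Lemma sum_blocks (F : nmodType) (f : nat -> F) N :
  \sum_(0 <= j < N) \sum_(r < n) f (n * j + r)%N = \sum_(0 <= m < n * N) f m.
Proof.
rewrite !big_mkord; elim: N => [|N IH]; first by rewrite muln0 !big_ord0.
by rewrite big_ord_recr /= IH mulnS addnC big_split_ord.
Qed.

End BlockIndex.

(** * The blocks of the transition matrix *)

Section Blocks.
Variables (R : realType) (n : nat) (beta a : R).
Hypotheses (hbeta : 0 < beta) (ha : a != 0).

Local Notation C := (Cplx R).
Local Notation U := (transition beta a).
Local Notation p := (fun k => toC (jac_off beta a k) : C).
Local Notation q := (fun k => toC (jac_diag beta a k) : C).
Local Notation J := (jacobi p q).

Lemma PopE (v : V R) : Pop beta a v = J v.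
Proof.
apply/funext => m.
rewrite -[LHS]/(- toC (sinh a / 2) * (Lplus beta v m + Lminus beta v m)
  + toC (cosh a) * (toC (lambda beta m) * v m)).
have rm k : rho_minus beta k.+1 = rho_plus beta k.
  by rewrite /rho_minus /rho_plus -natr1 addrA addrK.
have pE k : toC (jac_off beta a k) = - toC (sinh a / 2) * toC (rho_plus beta k).
  by rewrite -toCN -toCM.
have qE k : toC (jac_diag beta a k) = toC (cosh a) * toC (lambda beta k).
  by rewrite -toCM.
rewrite /jacobi /Lminus rm pE qE.
by case: m => [|m]; rewrite /Lplus ?pE; ring.
Qed.

Lemma iter_PopE m (v : V R) : iter m (Pop beta a) v = iter m J v.
Proof. by elim: m => // m IH; rewrite !iterS IH PopE. Qed.

Lemma V_sumE (f : 'I_n -> V R) m : (\sum_i f i) m = \sum_i (f i m : C).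
Proof. exact: (big_morph (fun v : V R => v m : C)). Qed.

Lemma mxact_evecE (X : 'M[C]_n) k i m :
  mxact X (evec R n k) i m = \sum_s X i s * delta C (n * k + s)%N m.
Proof. exact: V_sumE. Qed.

Lemma mxact_evec_block (X : 'M[C]_n) k l (i r : 'I_n) :
  mxact X (evec R n k) i (n * l + r)%N = if l == k then X i r else 0.
Proof.
rewrite mxact_evecE; under eq_bigr do rewrite /delta block_indexE.
case: eqP => _ /=; last by rewrite big1// => s _; rewrite mulr0.
rewrite (bigD1 r)//= eqxx mulr1 big1 ?addr0// => s sr.
by rewrite eq_sym (negPf sr) mulr0.
Qed.

Lemma sum_mxact_evec (X : 'M[C]_n) k i (v : nat -> C) M : (n * k.+1 <= M)%N ->
  \sum_(m < M) mxact X (evec R n k) i m * v m = \sum_s X i s * v (n * k + s)%N.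
Proof.
move=> kM; under eq_bigr do rewrite mxact_evecE mulr_suml.
rewrite exchange_big; apply: eq_bigr => s _.
under eq_bigr do rewrite -mulrA.
rewrite -mulr_sumr sum_delta// (leq_trans _ kM)// mulnS addnC ltn_add2r//.
Qed.

Definition ublock (k j : nat) : 'M[C]_n :=
  \matrix_(i, l) toC (U (n * k + i)%N (n * j + l)%N).

Lemma ublock_adj k j : (ublock k j)^t* = ublock j k.
Proof.
by apply/matrixP => i l; rewrite !mxE conj_toC transition_sym.
Qed.

Lemma mxip_evec_Phi j : mxip (evec R n 0) (Phi beta a n j) = ublock 0 j.
Proof. by apply/matrixP => i l; rewrite !mxE ip_ket conj_toC. Qed.

Lemma Lmx_Dsqrt j : ublock 0 j = Lmx beta a n j *m Dsqrt beta a n j.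
Proof.
apply/matrixP => i l; rewrite mul_mx_diag !mxE -toCM muln0 add0n.
by congr toC; rewrite /transition; ring.
Qed.

(** Row [i] evaluates a polynomial of exact degree [i] at the distinct points [n * j + l]. *)
Lemma Lmx_unit j : Lmx beta a n j \in unitmx.
Proof.
pose P (i : 'I_n) := invsqrt_sqnorm beta a i *: meixner_poly beta a i.
have -> : Lmx beta a n j = map_mx (real_complex R)
    (\matrix_(i, l < n) (P i).[(n * j + l)%:R]).
  by apply/matrixP => i l; rewrite !mxE hornerZ horner_meixner_poly.
rewrite map_unitmx; apply: (unitmx_horner (x := fun l : 'I_n => (n * j + l)%:R)).
  move=> i; rewrite size_scale ?size_meixner_poly//.
  rewrite invsqrt_sqnormE//; apply: mulf_neq0; last exact: sqrt_weight_neq0.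
  rewrite gt_eqF// sqrtr_gt0 powR_gt0// subr_gt0; exact: meixner_c_lt1.
move=> l l' /eqP; rewrite eqr_nat block_indexE => /andP[_ /eqP//].
Qed.

Lemma Dsqrt_unit j : Dsqrt beta a n j \in unitmx.
Proof.
rewrite unitmxE det_diag unitfE; apply/prodf_neq0 => i _.
by rewrite mxE toC_eq0; exact: sqrt_weight_neq0.
Qed.

Lemma ublock0_unit j : ublock 0 j \in unitmx.
Proof. by rewrite Lmx_Dsqrt unitmx_mul Lmx_unit Dsqrt_unit. Qed.

Lemma WE j : W beta a n j = ublock 0 j *m (ublock 0 j)^t*.
Proof.
rewrite Lmx_Dsqrt adjmxM /W !mulmxA; congr (_ *m _).
rewrite -mulmxA; congr (_ *m _).
apply/matrixP => i l; rewrite /Dsqrt tr_diag_mx map_diag_mx mul_diag_mx !mxE.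
case: eqP => [->|_]; last by rewrite !mulr0.
by rewrite /= !mulr1n [X in _ = _ * X]conj_toC -toCM -expr2 sqrt_weight2.
Qed.

Lemma alpha_adj j : (alpha beta n j)^t* = alpha beta n j.
Proof.
rewrite /alpha tr_diag_mx map_diag_mx; congr diag_mx.
by apply/rowP => i; rewrite !mxE; exact: conj_toC.
Qed.

(** [theta_j] is [alpha_j] conjugated by [U_(0,j)], so multiplying by it on the left becomes
    multiplying by [alpha_j] on the right. *)
Lemma theta_ublock0 j :
  theta beta a n j *m ublock 0 j = ublock 0 j *m alpha beta n j.
Proof.
by rewrite /theta mxip_evec_Phi alpha_adj mulmxKV// ublock0_unit.
Qed.

Lemma ublock_orthonormal k l : (0 < n)%N ->
  series (fun j => ublock k j *m (ublock l j)^t*) @ \oo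
  --> (if k == l then 1%:M else 0 : 'M[C]_n).
Proof.
move=> n0.
apply: (@cvg_mx_toC _ _ _ _
  (fun i r N => series (fun m => U (n * k + i)%N m * U (n * l + r)%N m) (n * N)%N)
  (fun i r => ((n * k + i == n * l + r)%N)%:R)).
- move=> N i r; rewrite /series /= summxE -sum_blocks toC_sum.
  apply: eq_bigr => j _; rewrite mxE toC_sum; apply: eq_bigr => s _.
  by rewrite !mxE conj_toC toCM.
- move=> i r; rewrite block_indexE.
  by case: eqP => _ /=; rewrite !mxE //; case: eqP.
(* [N] blocks amount to [n * N] scalar terms, so the limit is taken along a subsequence, which tends
   to infinity since [0 < n]. *)
- move=> i r; apply: (@cvg_comp _ _ _ (fun N => n * N)%N _ _ \oo); last exact: transition_orthonormal.
  move=> S [M _ MS]; exists M => // N MN; apply: MS => /=.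
  by rewrite (leq_trans MN)// leq_pmull.
Qed.

(** * The block recurrence and the polynomials [Pi_k] *)

Section Tridiagonal.
Variables A B : nat -> 'M[C]_n.
Hypothesis hAB : block_tridiagonal beta a A B.

Lemma block_tridiagonalE k (i : 'I_n) m :
  iter n J (delta C (n * k + i)) m =
  mxact ((A k.+1)^t*) (evec R n k.+1) i m + mxact (B k) (evec R n k) i m
  + (if k is k'.+1 then mxact (A k) (evec R n k') i m else 0).
Proof.
have := congr1 (fun w : Vn R n => w i m) (hAB k).
rewrite /opact iter_PopE => ->.
by case: k.
Qed.

(** The vectors [e_(k+1)], [e_k] and [e_(k-1)] have disjoint supports, so one coordinate of the
    defining relation isolates one matrix entry. *)
Lemma A_entry k (i r : 'I_n) :
  ((A k.+1)^t*) i r = iter n J (delta C (n * k + i)) (n * k.+1 + r)%N.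
Proof.
rewrite block_tridiagonalE !mxact_evec_block eqxx gtn_eqF// addr0.
case: k => [|k]; rewrite ?addr0// mxact_evec_block gtn_eqF ?addr0//.
Qed.

Lemma B_entry k (i r : 'I_n) :
  B k i r = iter n J (delta C (n * k + i)) (n * k + r)%N.
Proof.
rewrite block_tridiagonalE !mxact_evec_block eqxx ltn_eqF// add0r.
case: k => [|k]; rewrite ?addr0// mxact_evec_block gtn_eqF ?addr0//.
Qed.

Lemma B_adj k : (B k)^t* = B k.
Proof.
apply/matrixP => i r; rewrite !mxE !B_entry iter_jacobi_sym.
apply: conj_Creal; apply: iter_jacobi_real => m; try exact: toC_real.
by rewrite /delta realn.
Qed.

(** The band of [J^n] has half-width [n]: this block is lower triangular, and its diagonal is the
    nonzero edge of the band. *)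
Lemma A_adj_unit k : (A k.+1)^t* \in unitmx.
Proof.
rewrite unitmxE det_trig.
  rewrite unitfE; apply/prodf_neq0 => i _; rewrite A_entry.
  have -> : (n * k.+1 + i = n * k + i + n)%N by rewrite mulnS -addnA addnC.
  by apply: iter_jacobi_top => m; rewrite toC_eq0; exact: jac_off_neq0.
apply/is_trig_mxP => i r ir; rewrite A_entry iter_jacobi_gt//.
by rewrite mulnS [(n + _)%N]addnC -!addnA ltn_add2l addnC ltn_add2l.
Qed.

(** The relation defining [A] and [B] is paired with a column of [U], an eigenvector of [J]; the
    symmetry of [J] carries [J^n] over to that column. *)
Lemma ublock_recurrence k j :
  (A k.+1)^t* *m ublock k.+1 j + B k *m ublock k j
    + (if k is k'.+1 then A k *m ublock k' j else 0)
  = ublock k j *m alpha beta n j.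
Proof.
apply/matrixP => i l; rewrite mul_mx_diag !mxE.
pose v m : C := toC (U m (n * j + l)%N).
have vE : J v =1 (fun m => toC (mu beta (n * j + l)) * v m).
  move=> m; rewrite /v -toCM -(transition_eigen hbeta ha) /jacobi !toCD !toCM.
  by case: m => [|m]; rewrite ?toCM.
rewrite toCX -[RHS]mulrC -(iter_jacobi_eigen n vE).
(* Long enough for the support of [J^n] applied to [delta] at [n * k + i], and for the blocks up to
   [k.+1]. *)
pose M := (n * k.+3)%N.
rewrite -(@iter_jacobi_delta _ _ _ n (n * k + i)%N v M); last first.
  by rewrite /M; have := ltn_ord i; rewrite !mulnS; lia.
under [RHS]eq_bigr do rewrite block_tridiagonalE !mulrDl.
have kM m : (m <= k.+3)%N -> (n * m <= M)%N by move=> mk; rewrite leq_mul.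
have kM1 : (n * k.+1 <= M)%N by apply: kM; lia.
have kM2 : (n * k.+2 <= M)%N by apply: kM; lia.
rewrite !big_split /= !sum_mxact_evec//.
congr (_ + _ + _).
- by apply: eq_bigr => s _; congr (_ * _); rewrite mxE.
- by apply: eq_bigr => s _; congr (_ * _); rewrite mxE.
case: (k) @M {kM1 kM2} kM => [|k'] M kM; first by rewrite mxE big1// => s _; rewrite mul0r.
rewrite sum_mxact_evec; last by apply: kM; lia.
rewrite mxE.
by apply: eq_bigr => s _; congr (_ * _); rewrite mxE.
Qed.

Lemma ublock_difference k j :
  alpha beta n k *m ublock k j
  = ublock k j.+1 *m A j.+1 + ublock k j *m B j
    + (if j is j'.+1 then ublock k j' *m (A j)^t* else 0).
Proof.
have := congr1 (fun X : 'M[C]_n => X^t*) (ublock_recurrence j k).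
rewrite adjmxM alpha_adj ublock_adj => <-.
rewrite !adjmxD !adjmxM trmxCK B_adj !ublock_adj; congr (_ + _).
by case: j => [|j]; rewrite ?adjmx0// adjmxM ublock_adj.
Qed.

(* The coefficients of [Pi_k] and of [Pi_(k-1)], with [Pi_(-1) = 0]. *)
Fixpoint coef_pair (k : nat) : (nat -> 'M[C]_n) * (nat -> 'M[C]_n) :=
  if k is k'.+1 then
    let: (cur, prev) := coef_pair k' in
    (fun i => invmx ((A k)^t*) *m
      ((if i is i'.+1 then cur i' else 0) - B k' *m cur i - A k' *m prev i), cur)
  else (fun i => if i == 0%N then 1%:M else 0, fun=> 0).

Definition coef (k : nat) : nat -> 'M[C]_n := (coef_pair k).1.

(** This is recurrence (i) solved for the coefficients of [Pi_(k+1)]; multiplication by [x] shifts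
    the index. *)
Lemma coefS k i : coef k.+1 i = invmx ((A k.+1)^t*) *m
  ((if i is i'.+1 then coef k i' else 0) - B k *m coef k i
    - (if k is k'.+1 then A k *m coef k' i else 0)).
Proof.
rewrite /coef /=; case: k => [|k] /=; first by rewrite mulmx0.
by case: (coef_pair k).
Qed.

Lemma coef_gt k i : (k < i)%N -> coef k i = 0.
Proof.
suff : (forall i, (k < i)%N -> coef k i = 0) /\
       (forall i, (k.+1 < i)%N -> coef k.+1 i = 0) by move=> [H _] /H.
elim: k {i} => [|k [IH IHS]]; split=> //.
- by case.
- case=> // i i1; rewrite coefS /coef /=.
  by case: i i1 => // i _; rewrite /= !mulmx0 !subr0 mulmx0.
- case=> // i ki; rewrite coefS !IHS ?IH//; last by rewrite (ltn_trans _ ki).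
    by rewrite !mulmx0 !subr0 mulmx0.
  by rewrite ltnW// ltnW.
Qed.

(** In top degree only the shifted term survives, so the leading coefficient gains an invertible
    factor at each step. *)
Lemma coef_lead_unit k : coef k k \in unitmx.
Proof.
elim: k => [|k IH]; first by rewrite /coef /= unitmx1.
rewrite coefS [coef k k.+1]coef_gt// mulmx0 subr0.
have -> : (if k is k'.+1 then A k *m coef k' k.+1 else 0) = 0.
  by case: (k) => // k'; rewrite coef_gt// mulmx0.
by rewrite subr0 unitmx_mul unitmx_inv A_adj_unit IH.
Qed.

Lemma matpoly_widen k N (x : 'M[C]_n) : (k < N)%N ->
  matpoly coef k x = \sum_(i < N) coef k i *m x ^+ i.
Proof.
move=> kN; rewrite /matpoly.
rewrite -!(big_mkord xpredT (fun i => coef k i *m x ^+ i)).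
rewrite [RHS](big_cat_nat _ kN)//= [X in _ = _ + X]big_nat_cond.
rewrite [X in _ = _ + X]big1 ?addr0//.
by move=> i /andP[/andP[ki _] _]; rewrite coef_gt// mul0mx.
Qed.

Lemma matpoly0 (x : 'M[C]_n) : matpoly coef 0 x = 1%:M.
Proof. by rewrite /matpoly big_ord1 /coef /= expr0 mul1mx. Qed.

(** Coefficients stand on the left of the powers, so the identity holds for every matrix [x],
    without commutation. *)
Lemma matpoly_recurrence k (x : 'M[C]_n) :
  matpoly coef k x *m x = (A k.+1)^t* *m matpoly coef k.+1 x
    + B k *m matpoly coef k x
    + (if k is k'.+1 then A k *m matpoly coef k' x else 0).
Proof.
have E : (A k.+1)^t* *m matpoly coef k.+1 x = matpoly coef k x *m x
    - B k *m matpoly coef k x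
    - (if k is k'.+1 then A k *m matpoly coef k' x else 0).
  have -> : matpoly coef k x *m x
      = \sum_(i < k.+2) (if val i is i'.+1 then coef k i' else 0) *m x ^+ i.
    rewrite big_ord_recl /= mul0mx add0r /matpoly mulmx_suml.
    by apply: eq_bigr => i _; rewrite -mulmxA exprSr.
  have -> : (if k is k'.+1 then A k *m matpoly coef k' x else 0)
      = \sum_(i < k.+2) (if k is k'.+1 then A k *m coef k' i else 0) *m x ^+ i.
    case: (k) => [|k']; first by rewrite big1// => i _; rewrite mul0mx.
    have k3 : (k' < k'.+3)%N by lia.
    rewrite (matpoly_widen _ k3) mulmx_sumr.
    by apply: eq_bigr => i _; rewrite mulmxA.
  rewrite (@matpoly_widen k k.+2)// /matpoly !mulmx_sumr -!sumrB.
  apply: eq_bigr => i _; rewrite coefS !mulmxA mulmxV ?A_adj_unit// mul1mx.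
  by rewrite -!mulmxBl.
by rewrite E addrAC !subrK.
Qed.

(** Both sides start at [U_(0,j)] and satisfy the same recurrence, which determines the next term
    because [A_(k+1)^*] is invertible. *)
Lemma matpoly_ublock k j :
  matpoly coef k (theta beta a n j) *m ublock 0 j = ublock k j.
Proof.
set th := theta beta a n j.
suff : matpoly coef k th *m ublock 0 j = ublock k j /\
       matpoly coef k.+1 th *m ublock 0 j = ublock k.+1 j by case.
have next i : matpoly coef i th *m ublock 0 j = ublock i j ->
    (if i is i'.+1 then A i *m matpoly coef i' th else 0) *m ublock 0 j
      = (if i is i'.+1 then A i *m ublock i' j else 0) ->
    matpoly coef i.+1 th *m ublock 0 j = ublock i.+1 j.
  move=> Ei Ei'.
  have := congr1 (fun X : 'M[C]_n => X *m ublock 0 j) (matpoly_recurrence i th).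
  rewrite -mulmxA theta_ublock0 mulmxA Ei -ublock_recurrence !mulmxDl Ei'.
  rewrite -!mulmxA Ei => /addIr /addIr.
  by move=> /(congr1 (mulmx (invmx ((A i.+1)^t*)))); rewrite !mulKmx ?A_adj_unit// => ->.
elim: k => [|k [Ek EkS]]; split => //.
- by rewrite matpoly0 mul1mx.
- by apply: next; rewrite ?mul0mx// matpoly0 mul1mx.
- by apply: next => //; rewrite -mulmxA Ek.
Qed.

End Tridiagonal.

End Blocks.

Theorem mainTheorem5 (R : realType) (n : nat) (beta a : R)
    (hn : (1 <= n)%N) (hbeta : 0 < beta) (ha : a != 0)
    (A B : nat -> 'M[Cplx R]_n) (hAB : block_tridiagonal beta a A B) :
  let E := fun j : nat => mxip (evec R n 0) (Phi beta a n j) in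
  let th := theta beta a n in
  (forall j : nat,
      [/\ Lmx beta a n j \in unitmx,
          E j = Lmx beta a n j *m Dsqrt beta a n j
        & E j \in unitmx]) /\
  exists M : nat -> nat -> 'M[Cplx R]_n,
    (forall k : nat, M k k \in unitmx) /\
    (forall j k l : nat,
      [/\
        (matpoly M k (th j) *m th j
         = (A k.+1)^t* *m matpoly M k.+1 (th j)
           + B k *m matpoly M k (th j)
           + (if k is k'.+1 then A k *m matpoly M k' (th j) else 0))
        /\ matpoly M 0 (th j) = 1%:M,

        series (fun j' : nat => matpoly M k (th j') *m W beta a n j'
                                *m (matpoly M l (th j'))^t*) @ \oo
          --> (if k == l then 1%:M else 0 : 'M[Cplx R]_n)

      & Lambda beta n k *m matpoly M k (th j)
        = matpoly M k (th j.+1) *m E j.+1 *m A j.+1 *m invmx (E j)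
          + matpoly M k (th j) *m E j *m B j *m invmx (E j)
          + (if j is j'.+1
             then matpoly M k (th j') *m E j' *m (A j)^t* *m invmx (E j)
             else 0)]).
Proof.
move=> E th.
have EE j : E j = ublock n beta a 0 j by exact: mxip_evec_Phi.
split=> [j|].
  rewrite EE; split; [exact: Lmx_unit|exact: Lmx_Dsqrt|exact: ublock0_unit].
have key k j := matpoly_ublock hbeta ha hAB k j.
exists (coef A B); split=> [k|j k l]; first exact: (coef_lead_unit hbeta ha hAB).
split.
- split; last exact: matpoly0.
  exact: (matpoly_recurrence hbeta ha hAB).
(* As [W(j) = U_(0,j) U_(0,j)^*], each factor [U_(0,j)] joins one polynomial and the summand becomes
   [U_(k,j) U_(l,j)^*]. *)
- have -> : (fun j' : nat => matpoly (coef A B) k (th j') *m W beta a n j'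
      *m (matpoly (coef A B) l (th j'))^t*)
    = (fun j' => ublock n beta a k j' *m (ublock n beta a l j')^t*).
    apply/funext => j'; rewrite WE// mulmxA key -mulmxA -adjmxM.
    by rewrite key.
  exact: ublock_orthonormal.
- have unit0 := ublock0_unit n hbeta ha j.
  rewrite !EE !key.
  have -> : matpoly (coef A B) k (th j) = ublock n beta a k j *m invmx (ublock n beta a 0 j).
    by rewrite -key mulmxK.
  (* [Lambda] and [alpha] agree by conversion, since [lambda] and [mu] have the same formula. *)
  rewrite mulmxA [Lambda beta n k *m _](ublock_difference hbeta ha hAB).
  rewrite !mulmxDl; congr (_ + _).
  case: (j) => [|j']; first by rewrite mul0mx.
  by rewrite EE key.
Qed.
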